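(* For each prime power $q$, we have $$\frac{1}{q+1}\leq\liminf_{\alpha\in\mathcal{T}_q}h(\alpha)\leq\frac{1}{q-1}.$$
   Context: $\mathbb{F}_q(T)$ is the rational function field over the field with $q$ elements, $\overline{\mathbb{F}_q(T)}$ a fixed algebraic closure, and $\mathbb{F}_q((T))$ the field of formal Laurent series. The minimal polynomial of $\alpha\in\overline{\mathbb{F}_q(T)}$ is the unique polynomial $f\in\mathbb{F}_q[T][x]$ that is irreducible over $\mathbb{F}_q(T)$ as a polynomial in $x$, satisfies $f(\alpha)=0$, has coefficients in $\mathbb{F}_q[T]$ with no common factor, and whose leading coefficient (in $x$) is a monic polynomial in $T$. The height is $h(\alpha)=\deg_T(f)/\deg_x(f)$. An element $\alpha$ is totally $T$-adic if its minimal polynomial splits completely over $\mathbb{F}_q((T))$; $\mathcal{T}_q$ denotes the set of all totally $T$-adic elements of $\overline{\mathbb{F}_q(T)}$. For a (countably infinite) subset $L\subset\overline{\mathbb{F}_q(T)}$, choose an ordering $L=\{\alpha_1,\alpha_2,\ldots\}$ and define $\liminf_{\alpha\in L}h(\alpha)=\lim_{n\to\infty}\inf\{h(\alpha_i): i\geq n\}$; this is independent of the ordering. *)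

(* Defs.v *)
From HB Require Import structures.
From mathcomp Require Import all_boot all_order all_algebra.
From mathcomp Require Import zify.
From mathcomp Require Import all_classical all_reals all_analysis.

Set Implicit Arguments.
Unset Strict Implicit.
Unset Printing Implicit Defensive.

Import Order.TTheory GRing.Theory Num.Theory.

Local Open Scope classical_set_scope.
Local Open Scope ring_scope.
Local Open Scope quotient_scope.

Lemma fracE (R : idomainType) (x : {fraction R}) :
  exists a b : R, b != 0 /\ x = tofrac a / tofrac b.
Proof.
elim/quotW: x => r; exists r.1, r.2; have b0 := denom_ratioP r; split=> //.
apply: (canRL (mulfK _)); first by rewrite tofrac_eq0.
rewrite -[LHS]/(FracField.mul _ _) !piE; apply/eqmodP => /=.
rewrite FracField.equivfE /FracField.mulf !numden_Ratio ?mulf_neq0 ?oner_neq0 //.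
by rewrite !mulr1 mulrC.
Qed.

(* [f : fps F] is the formal power series \sum_n (f n) T^n, an element of F[[T]]. *)
Record fps (F : fieldType) := Fps { fps_coef :> nat -> F }.

HB.instance Definition _ (F : fieldType) := [isNew for @fps_coef F].
HB.instance Definition _ (F : fieldType) := [Choice of fps F by <:].

Section FpsRing.
Variable F : fieldType.
Implicit Types f g h : fps F.

Lemma fpsP f g : fps_coef f =1 fps_coef g -> f = g.
Proof. by move=> fg; apply: val_inj; apply: funext. Qed.

Definition fps_zero : fps F := Fps (fun _ => 0).
Definition fps_one : fps F := Fps (fun n => (n == 0)%:R).
Definition fps_opp f : fps F := Fps (fun n => - f n).
Definition fps_add f g : fps F := Fps (fun n => f n + g n).
Definition fps_mul f g : fps F := Fps (fun n => \sum_(i < n.+1) f i * g (n - i)%N).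

Fact fps_addA : associative fps_add.
Proof. by move=> f g h; apply: fpsP => n /=; rewrite addrA. Qed.
Fact fps_addC : commutative fps_add.
Proof. by move=> f g; apply: fpsP => n /=; rewrite addrC. Qed.
Fact fps_add0 : left_id fps_zero fps_add.
Proof. by move=> f; apply: fpsP => n /=; rewrite add0r. Qed.
Fact fps_addN : left_inverse fps_zero fps_opp fps_add.
Proof. by move=> f; apply: fpsP => n /=; rewrite addNr. Qed.

HB.instance Definition _ :=
  GRing.isZmodule.Build (fps F) fps_addA fps_addC fps_add0 fps_addN.

Let trunc N f : {poly F} := \poly_(i < N) f i.

Let coef_trunc N f n : (n < N)%N -> (trunc N f)`_n = f n.
Proof. by move=> nN; rewrite coef_poly nN. Qed.

Let coef_mul N f g n : (n < N)%N -> fps_mul f g n = (trunc N f * trunc N g)`_n.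
Proof.
move=> nN; rewrite coefM; apply: eq_bigr => i _.
rewrite !coef_trunc //; first exact: leq_ltn_trans (leq_subr _ _) nN.
by apply: leq_ltn_trans nN; rewrite -ltnS.
Qed.

Let coefM_eq (p p' r r' : {poly F}) n :
  (forall i, (i <= n)%N -> p`_i = p'`_i) ->
  (forall i, (i <= n)%N -> r`_i = r'`_i) -> (p * r)`_n = (p' * r')`_n.
Proof.
move=> pp rr; rewrite !coefM; apply: eq_bigr => i _.
by rewrite pp ?rr ?leq_subr // -ltnS.
Qed.

Fact fps_mulA : associative fps_mul.
Proof.
move=> f g h; apply: fpsP => n.
have tr u v : forall i, (i <= n)%N ->
    (trunc n.+1 (fps_mul u v))`_i = (trunc n.+1 u * trunc n.+1 v)`_i.
  by move=> i le_in; rewrite coef_trunc ?ltnS // (@coef_mul n.+1) ?ltnS.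
rewrite !(@coef_mul n.+1) //.
transitivity ((trunc n.+1 f * (trunc n.+1 g * trunc n.+1 h))`_n).
  by apply: coefM_eq => // i; apply: tr.
by rewrite mulrA; apply: coefM_eq => // i /tr.
Qed.
Fact fps_mulC : commutative fps_mul.
Proof.
by move=> f g; apply: fpsP => n; rewrite !(@coef_mul n.+1) // mulrC.
Qed.
Fact fps_mul1 : left_id fps_one fps_mul.
Proof.
move=> f; apply: fpsP => n /=; rewrite big_ord_recl /= mul1r subn0.
by rewrite big1 ?addr0 // => i _; rewrite mul0r.
Qed.
Fact fps_mulDl : left_distributive fps_mul +%R.
Proof.
move=> f g h; apply: fpsP => n /=; rewrite -big_split /=.
by apply: eq_bigr => i _; rewrite mulrDl.
Qed.
Fact fps_one_neq0 : fps_one != 0.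
Proof.
apply/eqP => /(congr1 (fun f => fps_coef f 0)) /= /eqP.
by rewrite oner_eq0.
Qed.

HB.instance Definition _ := GRing.Zmodule_isComNzRing.Build (fps F)
  fps_mulA fps_mulC fps_mul1 fps_mulDl fps_one_neq0.

Lemma fps_coefD f g n : (f + g) n = f n + g n. Proof. by []. Qed.
Lemma fps_coefM f g n : (f * g) n = \sum_(i < n.+1) f i * g (n - i)%N.
Proof. by []. Qed.

Fixpoint fps_inv_coefs f n : seq F :=
  if n is m.+1 then
    let s := fps_inv_coefs f m in
    rcons s ((f 0)^-1 * ((m == 0)%:R - \sum_(i < m) f i.+1 * s`_(m.-1 - i)))
  else [::].
(* Coefficients of the inverse, computed from f_0 g_0 = 1 and                  *)
(* f_0 g_n = - \sum_(0 < i <= n) f_i g_(n - i) for 0 < n.                      *)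
Definition fps_inv f : fps F :=
  if f 0 == 0 then f else Fps (fun n => (fps_inv_coefs f n.+1)`_n).
Definition fps_unit : {pred fps F} := fun f => f 0 != 0.

Let size_inv_coefs f n : size (fps_inv_coefs f n) = n.
Proof. by elim: n => //= n IHn; rewrite size_rcons IHn. Qed.

Let nth_inv_coefs f n i : (i < n)%N ->
  (fps_inv_coefs f n)`_i = (fps_inv_coefs f i.+1)`_i.
Proof.
elim: n => // n IHn; rewrite ltnS leq_eqVlt => /predU1P[-> //|lt_in].
by rewrite -IHn //= nth_rcons size_inv_coefs lt_in.
Qed.

Fact fps_mulVf : {in fps_unit, left_inverse 1 fps_inv *%R}.
Proof.
move=> f f0; rewrite mulrC; apply: fpsP => n.
rewrite /fps_inv (negPf f0) fps_coefM big_ord_recl subn0 /=.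
rewrite nth_rcons size_inv_coefs ltnn eqxx mulVKf //.
rewrite [X in _ + X](_ : _ =
    \sum_(i < n) f i.+1 * (fps_inv_coefs f n)`_(n.-1 - i)).
  by rewrite subrK.
apply: eq_bigr => i _; have lt_in := ltn_ord i.
rewrite /bump /= add1n [in RHS]nth_inv_coefs; last by lia.
by have -> : (n.-1 - i = n - i.+1)%N by lia.
Qed.

Fact fps_unitPl f g : g * f = 1 -> fps_unit f.
Proof.
move=> /(congr1 (fun u => fps_coef u 0)); rewrite fps_coefM big_ord1 /= => gf.
by apply/eqP => f0; move: gf; rewrite f0 mulr0 => /esym/eqP; rewrite oner_eq0.
Qed.

Fact fps_inv_out : {in [predC fps_unit], fps_inv =1 id}.
Proof. by move=> f; rewrite inE negbK /fps_inv => ->. Qed.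

HB.instance Definition _ := GRing.ComNzRing_hasMulInverse.Build (fps F)
  fps_mulVf fps_unitPl fps_inv_out.

Let fps_neq0 f : f != 0 -> exists2 n, f n != 0 & forall i, (i < n)%N -> f i = 0.
Proof.
move=> f0.
have ex : exists n, f n != 0.
  apply: contrapT => /forallNP nf; case/eqP: f0; apply: fpsP => n.
  by apply/eqP; rewrite -[_ == _]negbK; apply/negP/nf.
case: (ex_minnP ex) => n fn min_n; exists n => // i; rewrite ltnNge.
by apply: contraNeq => /min_n.
Qed.

Fact fps_integral f g : f * g = 0 -> (f == 0) || (g == 0).
Proof.
move=> fg; apply/norP => -[/fps_neq0[m fm f_lt] /fps_neq0[n gn g_lt]].
move/(congr1 (fun u => fps_coef u (m + n)%N)): fg; rewrite fps_coefM /=.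
have mlt : (m < (m + n).+1)%N by lia.
rewrite (bigD1 (Ordinal mlt)) //= addKn big1 ?addr0 => [|i].
  by move/eqP; rewrite mulf_eq0 (negPf fm) (negPf gn).
rewrite -val_eqE /= => im; have [lt_im|le_mi] := ltnP i m.
  by rewrite f_lt // mul0r.
have lt_mi : (m < i)%N by rewrite ltn_neqAle eq_sym im.
by rewrite g_lt ?mulr0 // ltn_subLR ?ltn_add2r //; have := ltn_ord i; lia.
Qed.

HB.instance Definition _ :=
  GRing.ComUnitRing_isIntegral.Build (fps F) fps_integral.

Definition fps_of_poly (p : {poly F}) : fps F := Fps (fun n => p`_n).

Fact fps_of_poly_zmod_morphism : zmod_morphism fps_of_poly.
Proof. by move=> p r; apply: fpsP => n; rewrite /= coefB. Qed.
Fact fps_of_poly_monoid_morphism : monoid_morphism fps_of_poly.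
Proof.
split=> [|p r]; apply: fpsP => n; rewrite ?fps_coefM /= ?coefM //.
by rewrite coefC; case: n.
Qed.
HB.instance Definition _ :=
  GRing.isZmodMorphism.Build _ _ fps_of_poly fps_of_poly_zmod_morphism.
HB.instance Definition _ :=
  GRing.isMonoidMorphism.Build _ _ fps_of_poly fps_of_poly_monoid_morphism.

(* F((T)) is the field of fractions of F[[T]]; by [laurentP] its elements are  *)
(* exactly the series T^-n * f with f in F[[T]].                               *)
Definition laurent := {fraction (fps F)}.
HB.instance Definition _ := GRing.Field.on laurent.

Definition laurent_of_poly : {poly F} -> laurent := @tofrac (fps F) \o fps_of_poly.
HB.instance Definition _ := GRing.RMorphism.on laurent_of_poly.

Let fps_shift f n : fps F := Fps (fun i => f (i + n)%N).
Let fps_XnE f n : (forall i, (i < n)%N -> f i = 0) ->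
  f = fps_of_poly 'X^n * fps_shift f n.
Proof.
move=> f0; apply: fpsP => k; rewrite fps_coefM.
have [lt_kn|le_nk] := ltnP k n.
  rewrite f0 // big1 // => i _; rewrite /= coefXn.
  by case: eqP => [|_]; rewrite ?mul0r // => i_n; have := ltn_ord i; lia.
have nlt : (n < k.+1)%N by [].
rewrite (bigD1 (Ordinal nlt)) //= coefXn eqxx mul1r subnK // big1 ?addr0 //.
by move=> i /negPf; rewrite -val_eqE /= coefXn => ->; rewrite mul0r.
Qed.

Lemma laurentP (x : laurent) :
  exists (n : nat) (f : fps F), x = tofrac f / laurent_of_poly 'X ^+ n.
Proof.
have [a [b [b0 ->]]] := fracE x.
have [n bn b_lt] := fps_neq0 b0; have bE := fps_XnE b_lt.
have u : fps_shift b n \is a GRing.unit by [].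
exists n, (a / fps_shift b n); rewrite rmorphM -mulrA; congr (_ * _).
rewrite -[laurent_of_poly 'X ^+ n]rmorphXn /= [in LHS]bE rmorphM invfM mulrC.
by rewrite rmorphV.
Qed.
End FpsRing.

Section TotallyTadic.
Variables (F : finFieldType) (K : closedFieldType).
Variable iota : {rmorphism {fraction {poly F}} -> K}.
Implicit Types (f g : {poly {poly F}}) (alpha : K).

(* In [{poly {poly F}}] the outer indeterminate is x and the inner one is T.  *)
Definition over_frac f : {poly {fraction {poly F}}} := map_poly (@tofrac _) f.

Definition is_minpoly alpha f :=
  [/\ irreducible_poly (over_frac f),
      root (map_poly iota (over_frac f)) alpha,
      forall d : {poly F}, (forall i, d %| f`_i) -> d %= 1
    & lead_coef f \is monic].

(* By [minpolyP] and [minpoly_unique] this is the only polynomial satisfying   *)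
(* [is_minpoly alpha] when alpha is algebraic over F(T).                       *)
Definition minpoly alpha : {poly {poly F}} := xget 0 [set f | is_minpoly alpha f].

(* [sizeY f] is the maximum of the sizes of the coefficients of f, so that    *)
(* (sizeY f).-1 is the degree of f in T, and (size f).-1 its degree in x.     *)
Definition height (R : realType) alpha : R :=
  let f := minpoly alpha in (sizeY f).-1%:R / (size f).-1%:R.

Definition splits_over_laurent f :=
  exists rs : seq (laurent F),
    map_poly (@laurent_of_poly F) f %= \prod_(r <- rs) ('X - r%:P).

Definition totally_Tadic : set K :=
  [set alpha | splits_over_laurent (minpoly alpha)].

Let over_fracZ (c : {poly F}) f : over_frac (c *: f) = tofrac c *: over_frac f.
Proof. exact: map_polyZ. Qed.

Let over_frac_inj : injective over_frac.
Proof. by apply: map_inj_poly => [a b /eqP|//]; rewrite tofrac_eq => /eqP. Qed.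

Let clear_denom (p : {poly {fraction {poly F}}}) :
  exists2 d : {poly F}, d != 0 & exists f, over_frac f = tofrac d *: p.
Proof.
elim/poly_ind: p => [|p c [d d0 [f fE]]].
  by exists 1; rewrite ?oner_eq0 //; exists 0; rewrite scaler0 /over_frac rmorph0.
have [a [b [b0 ->]]] := fracE c.
exists (d * b); first by rewrite mulf_neq0.
exists ((b *: f) * 'X + (d * a)%:P).
have -> : over_frac (b *: f * 'X + (d * a)%:P) =
    over_frac (b *: f) * 'X + (tofrac (d * a))%:P.
  by rewrite /over_frac rmorphD rmorphM /= map_polyX map_polyC.
rewrite over_fracZ fE scalerA scalerDr -scalerAl -tofracM [b * d]mulrC.
congr (_ + _); rewrite -mul_polyC -polyCM; congr _%:P.
by rewrite !tofracM -mulrA; congr (_ * _); rewrite mulrC divfK // tofrac_eq0.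
Qed.

Let primitive_part f : f != 0 -> exists c g,
  [/\ c != 0, f = c *: g, forall d : {poly F}, (forall i, d %| g`_i) -> d %= 1
    & lead_coef g \is monic].
Proof.
move=> f0.
have [c0 [c0_dvd c0_max]] : exists c0 : {poly F}, (forall i, c0 %| f`_i) /\
    forall d, (forall i, d %| f`_i) -> d %| c0.
  elim/poly_ind: f {f0} => [|f a [c [cf cM]]].
    by exists 0; split=> [i|d dP]; rewrite ?coef0 ?dvdp0.
  exists (gcdp c a); split=> [[|i]|d dP].
  - by rewrite coefD coefMX coefC add0r dvdp_gcdr.
  - by rewrite coefD coefMX coefC addr0 (dvdp_trans (dvdp_gcdl _ _)).
  rewrite dvdp_gcd; apply/andP; split.
    by apply: cM => i; have := dP i.+1; rewrite coefD coefMX coefC addr0.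
  by have := dP 0; rewrite coefD coefMX coefC add0r.
have c00 : c0 != 0.
  apply: contra_neq f0 => c0E; apply/polyP => i; apply/eqP.
  by rewrite coef0 -dvd0p; have := c0_dvd i; rewrite c0E.
pose g0 := \poly_(i < size f) (f`_i %/ c0).
have g0E i : g0`_i * c0 = f`_i.
  rewrite coef_poly; case: ltnP => [_|le_fi]; first by rewrite divpK.
  by rewrite mul0r nth_default.
have fE : f = c0 *: g0 by apply/polyP => i; rewrite coefZ mulrC g0E.
have g00 : lead_coef (lead_coef g0) != 0.
  by rewrite !lead_coef_eq0; apply: contra_neq f0 => g00; rewrite fE g00 scaler0.
set u := lead_coef _ in g00.
exists (c0 * u%:P), ((u^-1)%:P *: g0); split.
- by rewrite mulf_neq0 // polyC_eq0.
- by rewrite scalerA -mulrA -polyCM mulfV // mulr1.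
- move=> d dP; have: c0 * d %| c0 * 1.
    rewrite mulr1; apply: c0_max => i; rewrite -g0E mulrC dvdp_mul2r //.
    by have := dP i; rewrite coefZ mul_polyC dvdpZr // invr_eq0.
  by rewrite dvdp_mul2l // dvdp1 size_poly_eq1.
- by rewrite lead_coefZ monicE lead_coefM lead_coefC mulVf.
Qed.

Let irr_eqp (p q : {poly {fraction {poly F}}}) :
  p %= q -> irreducible_poly p -> irreducible_poly q.
Proof.
move=> pq [p1 pP]; split=> [|r r1 rq]; first by rewrite -(eqp_size pq).
by rewrite -(eqp_rtrans pq); apply: pP => //; rewrite (eqp_dvdr _ pq).
Qed.

Lemma minpoly_ex alpha : algebraicOver iota alpha -> exists f, is_minpoly alpha f.
Proof.
move=> [p0 p00 rp0].
pose P n := `[< exists p, [/\ p != 0, root (map_poly iota p) alpha & size p = n] >].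
have exP : exists n, P n by exists (size p0); apply/asboolP; exists p0.
case: (ex_minnP exP) => n /asboolP[p [p_neq0 rp sp]] min_n.
have irr_p : irreducible_poly p.
  split=> [|r r1 rp_dvd].
    rewrite ltnNge; apply/negP => /size1_polyC pE; move: rp p_neq0.
    by rewrite pE map_polyC rootC fmorph_eq0 polyC_eq0 => ->.
  have [s pE] := dvdpP _ _ rp_dvd.
  have /norP[s0 r0] : ~~ ((s == 0) || (r == 0)) by rewrite -mulf_eq0 -pE.
  rewrite -dvdp_size_eqp // eqn_leq dvdp_leq //= sp.
  move: rp; rewrite pE rmorphM rootM => /orP[rs|rr]; last first.
    by apply: min_n; apply/asboolP; exists r.
  have : (n <= size s)%N by apply: min_n; apply/asboolP; exists s.
  rewrite -sp pE size_mul //; move: r1 r0 s0; rewrite -!size_poly_gt0.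
by move: (size r) (size s) => k l; clear; lia.
have [d d0 [f fE]] := clear_denom p.
have f0 : f != 0.
  apply/eqP => f0; move: fE; rewrite f0 /over_frac rmorph0 => /esym/eqP.
  by rewrite scaler_eq0 tofrac_eq0 (negPf d0) (negPf p_neq0).
have [c [g [c0 fg gprim glead]]] := primitive_part f0.
have pg : p %= over_frac g.
  apply/eqpP; exists (tofrac d, tofrac c); first by rewrite /= !tofrac_eq0 d0 c0.
  by rewrite /= -fE fg over_fracZ.
exists g; split=> //; first exact: irr_eqp pg irr_p.
have pg' : map_poly iota p %= map_poly iota (over_frac g) by rewrite eqp_map.
by rewrite -(eqp_root pg').
Qed.

Lemma minpoly_unique alpha f g : is_minpoly alpha f -> is_minpoly alpha g -> f = g.
Proof.
move=> [irf rf pf lf] [irg rg pg lg].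
have fg : over_frac f %= over_frac g.
  set d := gcdp (over_frac f) (over_frac g).
  have rd : root (map_poly iota d) alpha by rewrite gcdp_map root_gcd rf rg.
  have d1 : size d != 1.
    apply/eqP => /eqP/size_poly1P[c c0 dE]; move: rd.
    by rewrite dE map_polyC rootC fmorph_eq0 (negPf c0).
  have df := irf.2 d d1 (dvdp_gcdl _ _); have dg := irg.2 d d1 (dvdp_gcdr _ _).
  by rewrite -(eqp_ltrans df).
have [x x0 xE] := eqpf_eq _ _ fg.
have [a [b [b0 xab]]] := fracE x.
have a0 : a != 0 by apply: contra_neq x0 => a0; rewrite xab a0 rmorph0 mul0r.
have {x x0 xE xab fg} ab : b *: f = a *: g.
  apply: over_frac_inj; rewrite !over_fracZ xE scalerA; congr (_ *: _).
  have tb : tofrac b != 0 by rewrite tofrac_eq0.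
  by rewrite xab mulrC (divfK tb).
set d := gcdp a b; have d0 : d != 0 by rewrite gcdp_eq0 negb_and a0.
have aE := divpK (dvdp_gcdl a b : d %| a); have bE := divpK (dvdp_gcdr a b : d %| b).
set a' := a %/ d in aE; set b' := b %/ d in bE.
have cop : coprimep a' b' by rewrite coprimep_div_gcd ?a0.
have {}ab : b' *: f = a' *: g.
  apply: (@mulfI _ d%:P); rewrite ?polyC_eq0 // !mul_polyC.
  by rewrite !scalerA ![d * _]mulrC aE bE.
have a'1 : a' %= 1.
  apply: pf => i; rewrite -(Gauss_dvdpr _ cop) -coefZ ab coefZ.
  exact: dvdp_mulIl.
have b'1 : b' %= 1.
  apply: pg => i; rewrite -(@Gauss_dvdpr _ _ a' b') 1?coprimep_sym // -coefZ -ab coefZ.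
  exact: dvdp_mulIl.
move: a'1 b'1; rewrite -!size_poly_eq1 => /size_poly1P[u u0 uE] /size_poly1P[v v0 vE].
move: ab; rewrite uE vE => ab.
have : lead_coef (lead_coef (v%:P *: f)) = lead_coef (lead_coef (u%:P *: g)).
  by rewrite ab.
rewrite !lead_coefZ !lead_coefM !lead_coefC (monicP lf) (monicP lg) !mulr1 => vu.
by apply: (@mulfI _ u%:P%:P); rewrite ?polyC_eq0 // !mul_polyC -ab vu.
Qed.

Lemma minpolyP alpha : algebraicOver iota alpha -> is_minpoly alpha (minpoly alpha).
Proof. by move=> /minpoly_ex[f fP]; apply: (@xgetI _ _ _ f). Qed.

Let minpoly_eq alpha f : is_minpoly alpha f -> minpoly alpha = f.
Proof. by move=> fP; apply: xget_unique => // g gP; apply: minpoly_unique gP fP. Qed.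

Let minpoly_rat (a : {poly F}) :
  is_minpoly (iota (tofrac a)) ('X - a%:P).
Proof.
have E : over_frac ('X - a%:P) = 'X - (tofrac a)%:P.
  by rewrite /over_frac rmorphB /= map_polyX map_polyC.
split; rewrite ?E.
- exact: irredp_XsubC.
- by rewrite rmorphB /= map_polyX map_polyC root_XsubC.
- by move=> d /(_ 1); rewrite coefB coefX coefC subr0 dvdp1 size_poly_eq1.
- by rewrite lead_coefXsubC monic1.
Qed.

Let rat_totally_Tadic (a : {poly F}) : totally_Tadic (iota (tofrac a)).
Proof.
rewrite /totally_Tadic /= (minpoly_eq (minpoly_rat a)).
exists [:: laurent_of_poly a].
by rewrite big_seq1 rmorphB /= map_polyX map_polyC eqpxx.
Qed.

Lemma totally_Tadic_enumerable : (forall alpha, algebraicOver iota alpha) ->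
  exists s : nat -> K, set_bij [set: nat] totally_Tadic s.
Proof.
move=> algK.
have inf : infinite_set totally_Tadic.
  pose t (n : nat) := iota (tofrac ('X^n : {poly F})).
  have t_inj : injective t.
    move=> m n /fmorph_inj/eqP; rewrite tofrac_eq => /eqP.
    by move=> /(congr1 (fun p : {poly F} => size p)); rewrite !size_polyXn => -[].
  have : infinite_set (range t).
    apply/infiniteP; rewrite (card_le_eqr (inj_card_eq _)) ?card_lexx //.
    by move=> m n _ _ /t_inj.
  by apply: sub_infinite_set => _ [n _ <-]; apply: rat_totally_Tadic.
have cnt : countable totally_Tadic.
  pose rts f : set K := [set x | f != 0 /\ root (map_poly iota (over_frac f)) x].
  apply: (@sub_countable _ _ _ (\bigcup_(f in [set: {poly {poly F}}]) rts f)).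
    apply: subset_card_le => x _; exists (minpoly x) => //.
    have [[sz _] r _ _] := minpolyP (algK x); split=> //.
    by apply: contraTneq sz => ->; rewrite /over_frac rmorph0 size_poly0.
  apply: bigcup_countable => [|f _]; first exact: countableP.
  apply: finite_set_countable.
  have [->|f0] := eqVneq f 0.
    by apply: (sub_finite_set (B := set0)) => // x [/eqP].
  have [rs rsE] := closed_field_poly_normal (map_poly iota (over_frac f)).
  apply: (sub_finite_set (B := [set` rs])); last exact: finite_seq.
  move=> x [_]; rewrite rsE rootZ ?root_prod_XsubC //.
  rewrite lead_coef_eq0 map_poly_eq0 -(inj_eq over_frac_inj) in f0 *.
  by move: f0; rewrite {2}/over_frac rmorph0.
have := eq_card_nat cnt inf; rewrite card_eq_sym.
pose Kp : pointedType := HB.pack (GRing.ClosedField.sort K) (Choice.on (GRing.ClosedField.sort K)) (isPointed.Build K 0).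
by move=> /(@card_set_bijP _ Kp).
Qed.

End TotallyTadic.

(* Main.v *)
From HB Require Import structures.
Require Import Defs.
From mathcomp Require Import all_boot all_order all_algebra all_field.
From mathcomp Require Import polyXY zify ring.
From mathcomp Require Import all_classical all_reals all_analysis.

Set Implicit Arguments.
Unset Strict Implicit.
Unset Printing Implicit Defensive.

Import Order.TTheory GRing.Theory Num.Theory.

Local Open Scope classical_set_scope.
Local Open Scope ring_scope.

(** The proof compares the minimal polynomial f of alpha, of degree n in x and
D in T, with the q + 1 points of the projective line over F = F_q.

Lower bound. If alpha is not in F, then the value of f at each point c of F
and at infinity, where it is the leading coefficient, is a nonzero polynomial
in T of degree at most D. If moreover f splits over F((T)), write it over
F[[T]] as u \prod_j (b_j x - a_j), where a_j and b_j are not both divisible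
by T; then u lies in F[[T]] by the lemma of Gauss ([split_linear_forms]).
Every root a_j / b_j reduces modulo T to a point of P^1(F), so it makes one of
the q + 1 values divisible by T ([vanishes_proj_line]). Thus T^n divides the
product of the values, which yields n <= (q + 1) D
([size_le_sizeY_of_split]). Hence the height is at least 1 / (q + 1) at all
totally T-adic elements outside the finite set F.

Upper bound. Let phi(y) = (y^q - y) / T. For a in F[[T]] the equation
phi(y) = a is y^q - y = T a, whose q solutions all lie in F[[T]]
([artin_schreier_fps], [expr_card_sub_prod]). By induction phi^k(y) = 1 has
all its q^k solutions in F[[T]] ([splits_iter_phi]). Clearing denominators
gives a polynomial [phi_fiber] of degree q^k in x and of degree at most
(q^k - 1) / (q - 1) in T. It need not be irreducible for what follows: by the
lemma of Gauss both degrees are additive over its irreducible factors, so one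
of these factors has a ratio of degrees at most 1 / (q - 1)
([exists_root_small_minpoly]). A root of this factor is totally T-adic of
height at most 1 / (q - 1). The roots found for different k differ, because
phi(1) = phi(0) = 0, so an orbit of phi meets 1 at most once; therefore there
are infinitely many of them. *)

(** * Order of vanishing and residues of power series *)

Section PowerSeries.
Variable F : fieldType.
Implicit Types f g : fps F.

Definition vanishes N f := forall n, (n < N)%N -> f n = 0.

Lemma vanishesP N f :
  vanishes N f <-> exists g, f = fps_of_poly 'X^N * g.
Proof.
split=> [f0|[g ->] n nN]; last first.
  rewrite fps_coefM big1 // => i _; rewrite /= coefXn.
  by case: eqP => [iN|_]; rewrite ?mul0r //; have := ltn_ord i; lia.
exists (Fps (fun i => f (i + N)%N)); apply: fpsP => k; rewrite fps_coefM.
have [lt_kN|le_Nk] := ltnP k N.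
  rewrite f0 // big1 // => i _; rewrite /= coefXn.
  by case: eqP => [iN|_]; rewrite ?mul0r //; have := ltn_ord i; lia.
have Nlt : (N < k.+1)%N by [].
rewrite (bigD1 (Ordinal Nlt)) //= coefXn eqxx mul1r subnK // big1 ?addr0 //.
by move=> i /negPf; rewrite -val_eqE /= coefXn => ->; rewrite mul0r.
Qed.

Lemma vanishesM M N f g :
  vanishes M f -> vanishes N g -> vanishes (M + N) (f * g).
Proof.
move=> /vanishesP[f' ->] /vanishesP[g' ->]; apply/vanishesP.
by exists (f' * g'); rewrite mulrACA -rmorphM exprD.
Qed.

Lemma vanishesMl N f g : vanishes N g -> vanishes N (f * g).
Proof. by move=> g0; apply: (@vanishesM 0) g0. Qed.

Lemma vanishes_exp N f m : vanishes N f -> vanishes (N * m) (f ^+ m).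
Proof.
move=> f0; elim: m => [|m IHm]; first by move=> n; rewrite muln0.
by rewrite exprS mulnS; apply: vanishesM.
Qed.

Lemma vanishes_prod (I : Type) (r : seq I) (E : I -> fps F) :
  (forall i, vanishes 1 (E i)) -> vanishes (size r) (\prod_(i <- r) E i).
Proof.
move=> E0; elim: r => [|i r IHr]; first by move=> n.
by rewrite big_cons /= -add1n; apply: vanishesM.
Qed.

Lemma fps_coef_sum (I : Type) (r : seq I) (E : I -> fps F) n :
  (\sum_(i <- r) E i) n = \sum_(i <- r) E i n.
Proof. by elim/big_rec2: _ => // i x y _ <-; rewrite fps_coefD. Qed.

Definition fps_residue f : F := f 0.

Fact fps_residue_zmod_morphism : zmod_morphism fps_residue.
Proof. by []. Qed.
Fact fps_residue_monoid_morphism : monoid_morphism fps_residue.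
Proof. by split=> // f g; rewrite /fps_residue fps_coefM big_ord1. Qed.
HB.instance Definition _ :=
  GRing.isZmodMorphism.Build _ _ fps_residue fps_residue_zmod_morphism.
HB.instance Definition _ :=
  GRing.isMonoidMorphism.Build _ _ fps_residue fps_residue_monoid_morphism.

Lemma vanishes_residue f : fps_residue f = 0 -> vanishes 1 f.
Proof. by move=> f0 []. Qed.

Lemma fps_of_poly_inj : injective (@fps_of_poly F).
Proof.
move=> p r pr; apply/polyP => i.
exact: (congr1 (fun f : fps F => f i) pr).
Qed.

Lemma laurent_of_poly_inj : injective (@laurent_of_poly F).
Proof. by move=> p r /eqP; rewrite tofrac_eq => /eqP/fps_of_poly_inj. Qed.

Lemma laurent_X_neq0 : laurent_of_poly ('X : {poly F}) != 0.
Proof.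
by rewrite -(rmorph0 (@laurent_of_poly F)) (inj_eq laurent_of_poly_inj) polyX_eq0.
Qed.

(** Dividing numerator and denominator by T as long as possible gives
coordinates that define a point of P^1(F) after reduction modulo T. *)
Lemma laurent_coprime_ratio (x : laurent F) : exists ab : fps F * fps F,
  [/\ ab.2 != 0, (fps_residue ab.1 != 0) || (fps_residue ab.2 != 0)
    & x = tofrac ab.1 / tofrac ab.2].
Proof.
have [n [f ->]] := laurentP x; elim: n f => [|n IHn] f.
  by exists (f, 1); rewrite /= rmorph1 !oner_eq0 orbT expr0 tofrac1.
have [f0|f0] := eqVneq (fps_residue f) 0; last first.
  exists (f, fps_of_poly 'X ^+ n.+1); split; rewrite /= ?f0 //.
    by rewrite expf_neq0 // -tofrac_eq0 laurent_X_neq0.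
  by rewrite tofracXn.
have /vanishesP[g ->] := vanishes_residue f0.
have [ab [ab0 abr abE]] := IHn g; exists ab; split=> //.
rewrite -abE [_ ^+ n.+1]exprS invfM tofracM mulrACA divff ?mul1r //.
exact: laurent_X_neq0.
Qed.
End PowerSeries.

(** * The lower bound for polynomials that split over Laurent series *)

Section LowerBound.
Variable F : finFieldType.
Implicit Types f : {poly {poly F}}.
Local Notation tf := (@tofrac (fps F)).

(** The form b x - a whose zero on the projective line is the point a / b. *)
Definition linear_form (A : nzRingType) (ab : A * A) : {poly A} :=
  ab.2 *: 'X - ab.1%:P.

Lemma lead_coef_linear_form (A : idomainType) (ab : A * A) :
  ab.2 != 0 -> lead_coef (linear_form ab) = ab.2.
Proof.
move=> b0; rewrite /linear_form lead_coefDl ?lead_coefZ ?lead_coefX ?mulr1 //.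
by rewrite size_polyN size_scale // size_polyX ltnS size_polyC_leq1.
Qed.

Lemma linear_form_eq0 (A : nzRingType) (ab : A * A) :
  linear_form ab = 0 -> (ab.1 == 0) && (ab.2 == 0).
Proof.
move=> l0; have := congr1 (fun p : {poly A} => p`_0) l0.
have := congr1 (fun p : {poly A} => p`_1) l0.
rewrite !coefB !coefZ !coefX !coefC /= mulr1 mulr0 subr0 sub0r => -> /eqP.
by rewrite oppr_eq0 eqxx andbT.
Qed.

(** The scalar u is integral by the lemma of Gauss: a product of linear forms
with coprime coefficients stays nonzero modulo T, hence has an invertible
coefficient, and u is the quotient of a coefficient of f by it. *)
Lemma split_linear_forms f : f != 0 -> splits_over_laurent f ->
  exists (u : fps F) (ps : seq (fps F * fps F)),
  [/\ size ps = (size f).-1, forall ab, ab \in ps -> ab.2 != 0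
    & map_poly (@fps_of_poly F) f = u *: \prod_(ab <- ps) linear_form ab].
Proof.
move=> f0 [rs frs].
have size_f : size f = (size rs).+1.
  rewrite -(size_prod_XsubC _ id) -(eqp_size frs) size_map_inj_poly ?rmorph0 //.
  exact: laurent_of_poly_inj.
have [ps [szps ps0 psres rsE]] : exists ps : seq (fps F * fps F),
    [/\ size ps = size rs, forall ab, ab \in ps -> ab.2 != 0,
    forall ab, ab \in ps -> (fps_residue ab.1 != 0) || (fps_residue ab.2 != 0)
    & rs = [seq tofrac ab.1 / tofrac ab.2 | ab <- ps]].
  elim: rs {frs size_f} => [|r rs [ps [szps ps0 psres rsE]]]; first by exists [::].
  have [ab [ab0 abres abE]] := laurent_coprime_ratio r.
  exists (ab :: ps); split; rewrite /= ?szps -?abE -?rsE //.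
    by move=> x; rewrite inE => /predU1P[->|/ps0].
  by move=> x; rewrite inE => /predU1P[->|/psres].
pose G := \prod_(ab <- ps) linear_form ab.
have resG : map_poly (@fps_residue F) G != 0.
  rewrite /G rmorph_prod big_seq /= prodf_seq_neq0; apply/allP => ab _.
  apply/implyP => abps; apply: contraL (psres _ abps) => /eqP l0.
  rewrite negb_or !negbK; apply: (@linear_form_eq0 _ (_, _)); rewrite -{}l0.
  by rewrite /linear_form rmorphB /= map_polyC linearZ /= map_polyX.
have GE : map_poly tf G = (\prod_(ab <- ps) tf ab.2) *: \prod_(r <- rs) ('X - r%:P).
  rewrite rsE big_map -scaler_prod rmorph_prod; apply: eq_big_seq => ab /ps0 b0.
  rewrite /linear_form rmorphB /= map_polyC linearZ /= map_polyX scalerBr.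
  congr (_ - _); rewrite -mul_polyC -polyCM mulrC divfK // tofrac_eq0 //.
have B0 : \prod_(ab <- ps) tf ab.2 != 0.
  rewrite big_seq prodf_seq_neq0; apply/allP => ab _; apply/implyP => /ps0.
  by rewrite tofrac_eq0.
have [l fG] : exists l, map_poly (@laurent_of_poly F) f = l *: map_poly tf G.
  have fG : map_poly (@laurent_of_poly F) f %= map_poly tf G.
    by rewrite GE (eqp_trans frs) // eqp_sym eqp_scale.
  by have [l _ ->] := eqpf_eq _ _ fG; exists l.
have [i Gi] : exists i, fps_residue G`_i != 0.
  apply: contrapT => /forallNP G0; case/eqP: resG; apply/polyP => i.
  by rewrite coef_map coef0; apply/eqP; rewrite -[_ == _]negbK; apply/negP/G0.
have fE : map_poly (@laurent_of_poly F) f = map_poly tf (map_poly (@fps_of_poly F) f).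
  by rewrite -map_poly_comp.
have lE : l = tf (fps_of_poly f`_i / G`_i).
  have fi : tf (fps_of_poly f`_i) = l * tf G`_i.
    by have := congr1 (fun p : {poly laurent F} => p`_i) fG; rewrite coefZ !coef_map.
  have Gu : G`_i \is a GRing.unit by [].
  have Gt0 : tf G`_i != 0.
    by rewrite tofrac_eq0; apply: contraNneq Gi => ->; rewrite rmorph0.
  have -> : tf (fps_of_poly f`_i / G`_i) = tf (fps_of_poly f`_i) / tf G`_i.
    by rewrite [LHS]tofracM; congr (_ * _); apply: rmorphV.
  by apply: (canRL (mulfK Gt0)); rewrite fi.
exists (fps_of_poly f`_i / G`_i), ps; split=> //; first by rewrite szps size_f.
apply: (@map_inj_poly _ _ tf); rewrite ?rmorph0 //.
  by move=> x y /eqP; rewrite tofrac_eq => /eqP.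
by rewrite -fE fG lE map_polyZ.
Qed.

(** The factors are the values of the form at the points of P^1(F), and it
vanishes modulo T at the reduction of a / b: at infinity if T divides b, and
otherwise at the residue c of a / b. *)
Lemma vanishes_proj_line (ab : fps F * fps F) :
  vanishes 1 (ab.2 * \prod_(c : F) (linear_form ab).[fps_of_poly c%:P]).
Proof.
apply: vanishes_residue; rewrite rmorphM rmorph_prod /=.
have [->|b0] := eqVneq (fps_residue ab.2) 0; first by rewrite mul0r.
have l0 : fps_residue (linear_form ab).[fps_of_poly (fps_residue ab.1 / fps_residue ab.2)%:P] = 0.
  rewrite /linear_form !hornerE rmorphB rmorphM /= coefC.
  by rewrite mulrC divfK // subrr.
by rewrite (bigD1 (fps_residue ab.1 / fps_residue ab.2)) //= l0 mul0r mulr0.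
Qed.

(** The product of the values of f at the q + 1 points of P^1(F) is a nonzero
polynomial in T of degree at most (q + 1) deg_T f, and each of the deg_x f
roots of f contributes a factor T to it. *)
Lemma size_le_sizeY_of_split f : splits_over_laurent f -> f != 0 ->
    (forall c : F, f.[c%:P] != 0) ->
  ((size f).-1 <= #|F|.+1 * (sizeY f).-1)%N.
Proof.
move=> fs f0 fc.
have [u [ps [szps ps0 fE]]] := split_linear_forms f0 fs.
(* The leading coefficient is the value of f at the point at infinity. *)
pose H := lead_coef f * \prod_(c : F) f.[c%:P].
have H0 : H != 0.
  by rewrite mulf_neq0 ?lead_coef_eq0 //; apply/prodf_neq0.
have HE : fps_of_poly H = (u * \prod_(c : F) u) *
    \prod_(ab <- ps) (ab.2 * \prod_(c : F) (linear_form ab).[fps_of_poly c%:P]).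
  rewrite big_split /= exchange_big /= mulrACA -big_split /=.
  rewrite rmorphM rmorph_prod; congr (_ * _).
    transitivity (lead_coef (map_poly (@fps_of_poly F) f)).
      by rewrite lead_coef_map_inj ?rmorph0 //; apply: fps_of_poly_inj.
    rewrite fE lead_coefZ lead_coef_prod; congr (_ * _).
    by apply: eq_big_seq => ab /ps0 /lead_coef_linear_form.
  apply: eq_bigr => c _; rewrite -horner_map /= fE hornerZ horner_prod //.
have : vanishes (size ps) (fps_of_poly H).
  by rewrite HE; apply/vanishesMl/vanishes_prod => ab; apply: vanishes_proj_line.
move=> H_van; rewrite -szps.
have psH : (size ps < size H)%N.
  rewrite ltnNge; apply/negP => leH; case/eqP: H0; apply/polyP => i; rewrite coef0.
  have [iH|Hi] := ltnP i (size H); last by rewrite nth_default.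
  exact: (H_van i (leq_trans iH leH)).
have Y0 : (0 < sizeY f)%N by rewrite lt0n sizeY_eq0.
have prod_le (I : Type) (r : seq I) (E : I -> {poly F}) m :
    (forall i, (size (E i) <= m.+1)%N) ->
    (size (\prod_(i <- r) E i)%R <= (m * size r).+1)%N.
  move=> Em; elim: r => [|i r IHr]; first by rewrite big_nil size_poly1.
  rewrite big_cons (leq_trans (size_polyMleq _ _)) //=.
  have := Em i; move: IHr; rewrite mulnS.
  by move: (size (E i)) (size (\prod_(j <- r) E j)%R) (m * size r)%N; lia.
have arith (n h l p Y M : nat) : (n < h -> h <= (l + p).-1 -> l <= Y ->
    p <= M.+1 -> 0 < Y -> n <= Y.-1 + M)%N by lia.
rewrite mulSn; apply: (arith _ _ _ _ _ _ psH (size_polyMleq _ _)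
  (max_size_lead_coefXY f) _ Y0).
have := prod_le _ (index_enum F) (fun c => f.[c%:P]) (sizeY f).-1.
have -> : size (index_enum F) = #|F| by rewrite -sum1_size sum1_card.
by rewrite prednK // mulnC => /(_ (max_size_evalC f)).
Qed.
End LowerBound.


(** * The lemma of Gauss and minimal polynomials *)

Section GaussLemma.
Variable F : fieldType.
Implicit Types (d p : {poly F}) (f g h : {poly {poly F}}).

Definition primitive g := forall d, (forall i, d %| g`_i) -> d %= 1.

Lemma irreducible_dvdp_ex d :
  (1 < size d)%N -> exists2 p, irreducible_poly p & p %| d.
Proof.
have [n] := ubnP (size d); elim: n d => // n IHn d; rewrite ltnS => dn d1.
have [irr|] := pselect (irreducible_poly d); first by exists d.
move=> /not_andP[//|/existsNP[e /not_implyP[e1 /not_implyP[ed /negP ned]]]].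
have d0 : d != 0 by rewrite -size_poly_gt0 ltnW.
have e0 : e != 0 by apply: contraNneq d0 => e0; rewrite -dvd0p -e0.
have ed_lt : (size e < size d)%N.
  rewrite ltn_neqAle dvdp_leq // andbT.
  by apply: contra ned; rewrite dvdp_size_eqp.
have [||p irr pe] := IHn e; first exact: leq_trans ed_lt dn.
  by move: e1 e0; rewrite -size_poly_gt0; move: (size e) => k; lia.
by exists p => //; apply: dvdp_trans pe ed.
Qed.

(** This says that F[T]/(p)[x] is a domain, in terms of coefficients. *)
Lemma irreducible_dvd_coefM p g h : irreducible_poly p ->
  (forall i, p %| (h * g)`_i) -> (forall i, p %| h`_i) \/ (forall i, p %| g`_i).
Proof.
move=> irr hg; apply: contrapT => /not_orP[/existsNP exh /existsNP exg].
have {}exh : exists i, ~~ (p %| h`_i) by case: exh => i /negP; exists i.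
have {}exg : exists i, ~~ (p %| g`_i) by case: exg => i /negP; exists i.
case: (ex_minnP exh) => i hi min_i; case: (ex_minnP exg) => j gj min_j.
(* Modulo p the coefficient of degree i + j is the single product h_i g_j. *)
have := hg (i + j)%N; have lti : (i < (i + j).+1)%N by rewrite ltnS leq_addr.
rewrite coefM (bigD1 (Ordinal lti)) //= addKn dvdp_addl; last first.
  apply: (big_ind (fun x => p %| x)); first exact: dvdp0.
    by move=> x y; apply: dvdp_add.
  move=> k; rewrite -val_eqE /= => ki; have [lt_ki|le_ik] := ltnP k i.
    by apply/dvdp_mulr/negPn/negP => /min_i; rewrite leqNgt lt_ki.
  apply/dvdp_mull/negPn/negP => /min_j.
  by have := ltn_ord k; move: ki le_ik; clear; lia.
by rewrite Gauss_dvdpr ?(negPf gj) // irreducible_poly_coprime.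
Qed.

(** An irreducible factor of d divides h g, hence h because g is primitive, and
it can be cancelled; this lowers the degree of d until d is a unit. *)
Lemma primitive_dvd_of_scale d f g h : d != 0 -> primitive g ->
  d *: f = h * g -> exists h', f = h' * g.
Proof.
have [n] := ubnP (size d); elim: n d f g h => // n IHn d f g h.
rewrite ltnS => dn d0 gprim dfg; have [d1|d1] := leqP (size d) 1.
  exists ((d`_0)^-1%:P *: h); rewrite -scalerAl -dfg scalerA {2}(size1_polyC d1).
  rewrite -polyCM mulVf ?scale1r //.
  by apply: contraNneq d0 => d00; rewrite (size1_polyC d1) d00.
have [p irr pd] := irreducible_dvdp_ex d1; have p0 := irredp_neq0 irr.
have [|hp|gp] := @irreducible_dvd_coefM p g h irr.
- by move=> i; rewrite -dfg coefZ dvdp_mulr.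
- have dE := divpK pd; set e := d %/ p in dE.
  have hE : h = p *: \poly_(i < size h) (h`_i %/ p).
    apply/polyP => i; rewrite coefZ coef_poly mulrC.
    by case: ltnP => [_|hi]; rewrite ?divpK // mul0r nth_default.
  have e0 : e != 0 by apply: contraNneq d0 => e0; rewrite -dE e0 mul0r.
  apply: (IHn e f g _ _ e0 gprim).
    apply: leq_trans dn; rewrite -dE size_mul //; move: irr.1.
    by move: e0; rewrite -size_poly_gt0; move: (size e) (size p) => a b; lia.
  apply: (@mulfI _ p%:P); rewrite ?polyC_eq0 // mulrA !mul_polyC scalerA mulrC.
  by rewrite dE dfg {1}hE.
- by have := irr.1; rewrite (eqp_size (gprim p gp)) size_poly1.
Qed.
End GaussLemma.

Section MinimalPolynomial.
Variables (F : finFieldType) (K : closedFieldType).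
Variable iota : {rmorphism {fraction {poly F}} -> K}.
Implicit Types (f g : {poly {poly F}}) (alpha : K).

Local Notation lift f := (map_poly iota (over_frac f)).

Lemma over_frac_inj : injective (@over_frac F).
Proof. by apply: map_inj_poly => [a b /eqP|//]; rewrite tofrac_eq => /eqP. Qed.

Lemma size_over_frac f : size (over_frac f) = size f.
Proof. by apply: size_map_inj_poly => // a b /eqP; rewrite tofrac_eq => /eqP. Qed.

(** Pseudo-division by g in F[T][x] leaves a remainder that vanishes at alpha,
so it is 0, and primitivity of g removes the scalar of the pseudo-division. *)
Lemma is_minpoly_dvd alpha f g :
  is_minpoly iota alpha g -> root (lift f) alpha -> exists h, f = h * g.
Proof.
move=> [irr rg gprim _] rf.
have g0 : g != 0.
  by apply: contraTneq irr.1 => ->; rewrite /over_frac rmorph0 size_poly0.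
have fE := Pdiv.Idomain.divp_eq f g; set r := f %% g in fE.
suff r0 : r = 0.
  apply: (@primitive_dvd_of_scale _ (lead_coef g ^+ scalp f g) _ _ (f %/ g)) => //.
    by rewrite expf_neq0 // lead_coef_eq0.
  by rewrite fE r0 addr0.
have rr : root (lift r) alpha.
  have -> : r = lead_coef g ^+ scalp f g *: f - f %/ g * g by rewrite fE addrC addKr.
  move: rf rg; rewrite /root /over_frac !rmorphB !rmorphM /= -mul_polyC !rmorphM /=.
  by rewrite !hornerE => /eqP -> /eqP ->; rewrite !mulr0 subr0.
(* A common root of the irreducible g and of r makes g divide r, which is
too small unless it vanishes. *)
have gr : over_frac g %| over_frac r.
  set d := gcdp (over_frac g) (over_frac r).
  have rd : root (map_poly iota d) alpha by rewrite gcdp_map root_gcd rg rr.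
  have d1 : size d != 1.
    apply/eqP => /eqP/size_poly1P[c c0 dE]; move: rd.
    by rewrite dE map_polyC rootC fmorph_eq0 (negPf c0).
  by rewrite -(eqp_dvdl _ (irr.2 d d1 (dvdp_gcdl _ _))) dvdp_gcdr.
apply: over_frac_inj; rewrite [RHS](_ : _ = 0); last by rewrite /over_frac rmorph0.
apply/eqP; apply: contraTT gr => r0; apply/negP => /(dvdp_leq r0).
by rewrite !size_over_frac leqNgt ltn_modp g0.
Qed.

Lemma is_minpoly_eval_neq0 alpha f (c : {poly F}) :
  is_minpoly iota alpha f -> alpha != iota (tofrac c) -> f.[c] != 0.
Proof.
move=> [irr rf _ _]; apply: contra_neq => fc.
have : 'X - (tofrac c)%:P %| over_frac f.
  by rewrite dvdp_XsubCl /root /over_frac horner_map /= fc tofrac0.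
move=> /irr.2; rewrite size_XsubC => /(_ isT) Xf.
have : map_poly iota ('X - (tofrac c)%:P) %= lift f by rewrite eqp_map.
move=> /eqp_root/(_ alpha); rewrite rf rmorphB /= map_polyX map_polyC root_XsubC.
by move/eqP.
Qed.

Lemma height_ge (R : realType) alpha : algebraicOver iota alpha ->
  totally_Tadic iota alpha -> (forall c : F, alpha != iota (tofrac c%:P)) ->
  1 / (#|F|%:R + 1) <= height iota R alpha.
Proof.
move=> /minpolyP alg split_a nc; have [irr _ _ _] := alg.
have f1 : (1 < size (minpoly iota alpha))%N by rewrite -size_over_frac irr.1.
have f0 : minpoly iota alpha != 0 by rewrite -size_poly_gt0 ltnW.
rewrite /height natr1 ler_pdivrMr ?ltr0n // mulrAC ler_pdivlMr; last first.
  by rewrite ltr0n -ltnS prednK // ltnW.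
rewrite mul1r -natrM ler_nat mulnC; apply: size_le_sizeY_of_split => // c.
exact: is_minpoly_eval_neq0 alg (nc c).
Qed.
End MinimalPolynomial.

(** * Artin-Schreier equations over power series *)

Section ArtinSchreier.
Variable F : finFieldType.
Local Notation q := #|F|.

Section Frobenius.
Variables (S : comNzRingType) (j : {rmorphism F -> S}).
Implicit Types x y : S.

Lemma card_pnat_pchar : [pchar S].-nat q.
Proof.
have [p p_pr pF] := finPcharP F; rewrite (card_pprimeChar pF) pnatX.
by rewrite pnatE // (rmorph_pchar j pF).
Qed.

Lemma expr_cardB x y : (x - y) ^+ q = x ^+ q - y ^+ q.
Proof.
by rewrite -[x in RHS](subrK y) (exprDn_pchar (x - y) y card_pnat_pchar) addrK.
Qed.

Lemma expr_card_sub_prod x : x ^+ q - x = \prod_(c : F) (x - j c).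
Proof.
have := congr1 (fun p => (map_poly j p).[x]) (finField_genPoly F).
rewrite rmorphB rmorphXn rmorph_prod /= map_polyX !hornerE horner_prod => ->.
by apply: eq_bigr => c _; rewrite rmorphB /= map_polyX map_polyC !hornerE.
Qed.
End Frobenius.

Definition fps_const : F -> fps F := @fps_of_poly F \o polyC.
HB.instance Definition _ := GRing.RMorphism.on fps_const.

(** The solution is z = - \sum_i b^(q^i) with b = T a, as b -> b^q is additive.
The sum converges T-adically, since b^(q^i) is divisible by T^(q^i). *)
Lemma artin_schreier_fps (a : fps F) :
  exists z : fps F, z ^+ q - z = fps_of_poly 'X * a.
Proof.
set b := fps_of_poly 'X * a; have q1 : (1 < q)%N := finNzRing_gt1 F.
have q0 := ltnW q1.
have bV m : vanishes m (b ^+ m).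
  by rewrite -[X in vanishes X]mul1n; apply/vanishes_exp/vanishesP; exists a.
have expB := expr_cardB fps_const.
pose zN N := - \sum_(i < N.+1) b ^+ (q ^ i).
(* The terms with i > n do not contribute to the coefficient of degree n. *)
pose z : fps F := Fps (fun n => zN n n); exists z.
have zNE N : zN N ^+ q - zN N = b - b ^+ (q ^ N.+1).
  elim: N => [|N IHN].
    rewrite /zN big_ord1 expn0 expr1 expn1 -[- b]sub0r expB expr0n gtn_eqF //.
    by rewrite !sub0r opprK addrC.
  have -> : zN N.+1 = zN N - b ^+ (q ^ N.+1) by rewrite /zN big_ord_recr opprD.
  rewrite expB -exprM -expnSr.
  by rewrite opprD (opprK (b ^+ _)) addrACA IHN [- _ + _]addrC addrA subrK.
have zV N : vanishes N.+1 (z - zN N).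
  move=> n; rewrite ltnS => nN; rewrite fps_coefD.
  apply/eqP; rewrite subr_eq0; apply/eqP.
  rewrite /= /zN; congr (- _); rewrite !fps_coef_sum.
  rewrite (big_ord_widen N.+1 (fun i => (b ^+ (q ^ i)) n)) // big_mkcond.
  apply: eq_bigr => i _; case: ltnP => // ni; apply/esym/bV.
  by apply: leq_trans ni _; rewrite ltnW // ltn_expl.
apply: fpsP => N; rewrite -[z](subrK (zN N)).
move: (z - zN N) (zV N) => w wV.
rewrite (exprDn_pchar _ _ (card_pnat_pchar fps_const)) opprD addrACA zNE.
have wqV : vanishes N.+1 (w ^+ q).
  by rewrite -(prednK q0) exprSr; apply: vanishesMl.
rewrite !fps_coefD /= wqV // wV // (bV (q ^ N.+1)%N) ?oppr0 ?add0r ?addr0 //.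
by apply: ltnW; rewrite ltn_expl.
Qed.
End ArtinSchreier.

(** * The iteration of (y^q - y) / T *)

Section Dynamics.
Variable F : finFieldType.
Local Notation q := #|F|.

(** The argument t stands for 1 / T, so that S need not be a field: the map is
iterated on K and on polynomials over F((T)). *)
Definition phi (S : comNzRingType) (t y : S) := t * (y ^+ q - y).

Fixpoint phi_exp k := if k is k'.+1 then (q * phi_exp k').+1 else 0%N.

(** The numerator of the k-th iterate of phi at x over the denominator
T^(phi_exp k), as shown by [phi_numE]. *)
Fixpoint phi_num k : {poly {poly F}} :=
  if k is k'.+1 then
    phi_num k' ^+ q - ('X ^+ (phi_exp k' * q.-1))%:P * phi_num k'
  else 'X.

(** The roots are the solutions of phi^k(y) = 1. The target 1 is chosen because
it is not periodic under phi, which makes the fibers disjoint. *)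
Definition phi_fiber k : {poly {poly F}} := phi_num k - ('X ^+ phi_exp k)%:P.

Lemma phi_numE (S : comNzRingType) (h : {rmorphism {poly {poly F}} -> S}) t k :
  t * h 'X%:P = 1 ->
  h (phi_num k) = h 'X%:P ^+ phi_exp k * iter k (phi t) (h 'X).
Proof.
move=> tX; elim: k => [|k IHk] /=; first by rewrite expr0 mul1r.
rewrite rmorphB rmorphXn !rmorphM /= polyC_exp rmorphXn IHk.
set y := iter _ _ _; set T := h _; set e := phi_exp k.
have -> : T ^+ (q * e).+1 * phi t y = (t * T) * (T ^+ (q * e) * (y ^+ q - y)).
  by rewrite /phi exprS; ring.
rewrite tX mul1r exprMn mulrA -exprD -mulnSr prednK.
  by rewrite -exprM mulnC mulrBr.
exact: ltnW (finNzRing_gt1 F).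
Qed.

Lemma phi_fiberE (S : comNzRingType) (h : {rmorphism {poly {poly F}} -> S}) t k :
  t * h 'X%:P = 1 ->
  h (phi_fiber k) = h 'X%:P ^+ phi_exp k * (iter k (phi t) (h 'X) - 1).
Proof.
by move=> tX; rewrite rmorphB (phi_numE _ tX) polyC_exp rmorphXn mulrBr mulr1.
Qed.

(** The orbit of 1 is 1, 0, 0, and so on, and never returns to 1. *)
Lemma iter_phi_fibers_disjoint (S : comNzRingType) (t x : S) k l : (k < l)%N ->
  iter k (phi t) x = 1 -> iter l (phi t) x != 1.
Proof.
move=> kl kx; rewrite -(subnK kl) addnS -addSn iterD kx iterS.
have phi0 n : iter n (phi t) 0 = 0.
  elim: n => //= n ->; rewrite /phi expr0n gtn_eqF ?subrr ?mulr0 //.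
  exact: ltnW (finNzRing_gt1 F).
by rewrite -iterS iterSr {2}/phi expr1n subrr mulr0 phi0 eq_sym oner_eq0.
Qed.

Lemma phi_exp_pred k : (q.-1 * phi_exp k).+1 = (q ^ k)%N.
Proof.
have q1 : (0 < q)%N := ltnW (finNzRing_gt1 F).
elim: k => [|k IHk]; first by rewrite muln0.
by rewrite expnS -IHk /= !mulnS [(q.-1 * (q * _))%N]mulnCA -addSn prednK.
Qed.

Lemma size_phi_num k : size (phi_num k) = (q ^ k).+1.
Proof.
have q1 : (1 < q)%N := finNzRing_gt1 F.
elim: k => [|k IHk]; first by rewrite size_polyX.
have n0 : phi_num k != 0 by rewrite -size_poly_gt0 IHk.
have qk : (0 < q ^ k)%N by rewrite expn_gt0 ltnW.
have szX : size (phi_num k ^+ q) = (q ^ k.+1).+1.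
  have := size_exp (phi_num k) q; rewrite IHk /= -expnSr => <-.
  by rewrite prednK // size_poly_gt0 expf_neq0.
rewrite /= size_polyDl szX // size_polyN mul_polyC size_scale.
  by rewrite IHk !ltnS ltn_exp2l.
by rewrite -size_poly_gt0 size_polyXn.
Qed.

Lemma size_phi_fiber k : size (phi_fiber k) = (q ^ k).+1.
Proof.
rewrite /phi_fiber size_polyDl size_phi_num // size_polyN.
rewrite (leq_ltn_trans (size_polyC_leq1 _)) // ltnS expn_gt0.
by rewrite ltnW // finNzRing_gt1.
Qed.

Lemma sizeY_phi_fiber k : (sizeY (phi_fiber k) <= (phi_exp k).+1)%N.
Proof.
have q1 : (1 < q)%N := finNzRing_gt1 F.
have q0 := ltnW q1.
have swXn n : swapXY ('X ^+ n)%:P = 'X ^+ n :> {poly {poly F}}.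
  by rewrite swapXY_polyC rmorphXn /= map_polyX.
have addle (p r : {poly {poly F}}) n :
    (size p <= n -> size r <= n -> size (p - r)%R <= n)%N.
  by move=> pn rn; rewrite (leq_trans (size_polyD _ _)) // size_polyN geq_max pn.
have swB (p r : {poly {poly F}}) : swapXY (p - r) = swapXY p - swapXY r.
  exact: swapXY_is_zmod_morphism.
rewrite sizeYE swB swXn; apply: (addle _ _ _); last by rewrite size_polyXn.
elim: k => [|k IHk]; first by rewrite /= swapXY_X size_polyC_leq1.
rewrite [phi_num _]/= [phi_exp _]/= swB rmorphXn rmorphM /= swXn; apply: (addle _ _ _).
  apply: leq_trans (size_poly_exp_leq _ _) _; rewrite ltnS leqW // mulnC.
  by rewrite leq_mul2l; apply/orP; right; move: IHk; case: (size _).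
apply: leq_trans (size_polyMleq _ _) _; rewrite size_polyXn /=.
have : (phi_exp k * q.-1 + phi_exp k = q * phi_exp k)%N.
  by rewrite -mulnSr prednK // mulnC.
by move: IHk; move: (size _) (phi_exp k * _)%N (q * _)%N; lia.
Qed.

Section Splitting.
Local Notation L := (laurent F).

Definition splits (p : {poly L}) := exists rs, p %= \prod_(r <- rs) ('X - r%:P).

Lemma splits_prod (I : Type) (s : seq I) (E : I -> {poly L}) :
  (forall i, splits (E i)) -> splits (\prod_(i <- s) E i).
Proof.
move=> Es; elim: s => [|i s [rs rsE]].
  by exists [::]; rewrite !big_nil eqpxx.
have [ri riE] := Es i; exists (ri ++ rs); rewrite big_cons big_cat /=.
by rewrite (eqp_trans (eqp_mulr _ riE)) // eqp_mull.
Qed.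

(** The equation phi(y) = a amounts to y^q - y = T a; its q solutions z + c,
with c in F, are again in F[[T]], so that the argument can be repeated. *)
Lemma splits_iter_phi k (a : fps F) :
  splits (iter k (phi (laurent_of_poly 'X)^-1%:P) 'X - (tofrac a)%:P).
Proof.
elim: k a => [|k IHk] a.
  by exists [:: tofrac a]; rewrite big_seq1 eqpxx.
set Y := iter k _ _ in IHk; set t := (laurent_of_poly 'X)^-1.
have T0 := laurent_X_neq0 F.
have [z zE] := artin_schreier_fps a.
pose j : {rmorphism F -> {poly L}} := polyC \o @tofrac (fps F) \o @fps_const F.
have -> : iter k.+1 (phi t%:P) 'X - (tofrac a)%:P =
    t *: \prod_(c : F) (Y - (tofrac (z + fps_const c))%:P).
  have arith (S : comNzRingType) (u v y yq w b : S) : u * v = 1 ->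
      u * (yq - y) - b = u * (yq - (w + v * b) - (y - w)).
    by move=> uv; rewrite -[b in LHS]mul1r -uv; ring.
  transitivity (t *: ((Y - (tofrac z)%:P) ^+ q - (Y - (tofrac z)%:P))).
    rewrite (expr_cardB j) -polyC_exp -tofracXn.
    have -> : z ^+ q = z + fps_of_poly 'X * a by rewrite -zE addrC subrK.
    rewrite tofracD tofracM polyCD polyCM iterS -/Y /phi -mul_polyC.
    by apply: arith; rewrite -polyCM mulVf.
  rewrite (expr_card_sub_prod j); apply: (congr1 (fun p => t *: p)).
  apply: eq_bigr => c _.
  by rewrite tofracD polyCD opprD addrA.
have [rs rsE] := @splits_prod _ (index_enum F)
  (fun c => Y - (tofrac (z + fps_const c))%:P) (fun c => IHk _).
exists rs; apply: eqp_trans rsE; apply: eqp_scale; exact: invr_neq0 T0.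
Qed.
End Splitting.
End Dynamics.

(** * Totally T-adic elements of small height *)

Section UpperBound.
Variables (F : finFieldType) (K : closedFieldType).
Variable iota : {rmorphism {fraction {poly F}} -> K}.
Implicit Types (f g : {poly {poly F}}) (alpha : K).
Local Notation q := #|F|.
Local Notation lift f := (map_poly iota (over_frac f)).

Lemma splits_phi_fiber k : splits_over_laurent (phi_fiber F k).
Proof.
have T0 := laurent_X_neq0 F.
pose h : {rmorphism {poly {poly F}} -> {poly laurent F}} :=
  map_poly (@laurent_of_poly F).
have tX : (laurent_of_poly ('X : {poly F}))^-1%:P * h 'X%:P = 1.
  by rewrite /h /= map_polyC -polyCM mulVf.
have [rs rsE] := splits_iter_phi k (1 : fps F); exists rs.
apply: eqp_trans rsE.
have := phi_fiberE k tX; rewrite /h /= map_polyC map_polyX => ->.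
by rewrite -polyC_exp mul_polyC tofrac1; apply: eqp_scale; rewrite expf_neq0.
Qed.

Lemma splits_over_laurent_factor f g h :
  f = h * g -> splits_over_laurent f -> splits_over_laurent g.
Proof.
move=> -> [rs fE].
have : map_poly (@laurent_of_poly F) g %| \prod_(r <- rs) ('X - r%:P).
  by rewrite -(eqp_dvdr _ fE) rmorphM dvdp_mull.
by move=> /dvdp_prod_XsubC[m gE]; exists (mask m rs).
Qed.

Lemma root_phi_fiber k alpha : root (lift (phi_fiber F k)) alpha ->
  iter k (phi F (iota (tofrac 'X))^-1) alpha = 1.
Proof.
pose h : {rmorphism {poly {poly F}} -> K} :=
  horner_eval alpha \o map_poly iota \o map_poly (@tofrac {poly F}).
have X0 : iota (tofrac 'X) != 0 by rewrite fmorph_eq0 tofrac_eq0 polyX_eq0.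
have hT : h 'X%:P = iota (tofrac 'X).
  by rewrite /h /= /horner_eval !map_polyC hornerC.
have hX : h 'X = alpha by rewrite /h /= /horner_eval !map_polyX hornerX.
have tX : (iota (tofrac 'X))^-1 * h 'X%:P = 1 by rewrite hT mulVf.
have := phi_fiberE k tX; rewrite hT hX => hE.
rewrite /root [X in X == 0](_ : _ = h (phi_fiber F k)) // hE.
by rewrite mulf_eq0 expf_eq0 (negPf X0) andbF subr_eq0 => /eqP.
Qed.

Lemma sizeYM f g : f != 0 -> g != 0 ->
  (sizeY (f * g)).-1 = ((sizeY f).-1 + (sizeY g).-1)%N.
Proof.
move=> f0 g0; rewrite !sizeYE rmorphM size_mul ?swapXY_eq0 //.
move: f0 g0; rewrite -swapXY_eq0 -size_poly_gt0 -[g == 0]swapXY_eq0 -size_poly_gt0.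
by move: (size _) (size _) => a b; lia.
Qed.

Hypothesis algK : forall alpha, algebraicOver iota alpha.

(** Both degrees are additive in products, so if the minimal polynomial of a
root of f violates the bound, then the cofactor satisfies it strictly, and the
search continues among the roots of the cofactor. *)
Lemma exists_root_small_minpoly m f : (1 < size f)%N ->
    (m * (sizeY f).-1 <= (size f).-1)%N ->
  exists2 alpha, root (lift f) alpha &
    (m * (sizeY (minpoly iota alpha)).-1 <= (size (minpoly iota alpha)).-1)%N.
Proof.
have [n] := ubnP (size f); elim: n f => // n IHn f; rewrite ltnS => fn f1 fm.
have [alpha ra] : exists alpha, root (lift f) alpha.
  by apply/closed_rootP; rewrite size_map_poly size_over_frac; lia.
have gP := minpolyP (algK alpha); set g := minpoly iota alpha in gP.
have [small|big] := leqP (m * (sizeY g).-1) (size g).-1; first by exists alpha.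
have [h fE] := is_minpoly_dvd gP ra.
have g1 : (1 < size g)%N by case: gP => -[]; rewrite size_over_frac.
have f0 : f != 0 by rewrite -size_poly_gt0 ltnW.
have /norP[h0 g0] : ~~ ((h == 0) || (g == 0)) by rewrite -mulf_eq0 -fE.
have szf : (size f).-1 = ((size h).-1 + (size g).-1)%N.
  rewrite fE size_mul //; move: h0 g1; rewrite -size_poly_gt0.
  by move: (size h) (size g) => a b; lia.
have := sizeYM h0 g0; rewrite -fE => szYf; rewrite szYf mulnDr szf in fm.
have [|||beta rb bm] := IHn h; last first.
  by exists beta => //; rewrite fE /over_frac !rmorphM rootM rb.
- by move: fm big; move: (m * _)%N (m * _)%N (size h) (size g) => a b c d; lia.
- by move: fm big; move: (m * _)%N (m * _)%N (size h) (size g) => a b c d; lia.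
- apply: leq_trans fn; move: szf f1 g1 h0; rewrite -size_poly_gt0.
  by move: (size f) (size g) (size h) => a b c; lia.
Qed.

Lemma exists_small_totally_Tadic k : exists alpha,
  [/\ totally_Tadic iota alpha, forall R : realType,
      height iota R alpha <= 1 / (q%:R - 1)
    & iter k (phi F (iota (tofrac 'X))^-1) alpha = 1].
Proof.
have q1 : (1 < q)%N := finNzRing_gt1 F.
have qk : (0 < q ^ k)%N by rewrite expn_gt0 ltnW.
have [||alpha ra small] := @exists_root_small_minpoly q.-1 (phi_fiber F k).
- by rewrite size_phi_fiber.
- rewrite size_phi_fiber /= -phi_exp_pred leqW // leq_mul2l; apply/orP; right.
  by have := sizeY_phi_fiber F k; case: (sizeY _).
have gP := minpolyP (algK alpha); have [h fE] := is_minpoly_dvd gP ra.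
exists alpha; split; last exact: root_phi_fiber.
  exact: splits_over_laurent_factor fE (splits_phi_fiber k).
move=> R; have g1 : (1 < size (minpoly iota alpha))%N.
  by case: gP => -[]; rewrite size_over_frac.
rewrite /height ler_pdivrMr ?ltr0n; last by rewrite -ltnS prednK // ltnW.
rewrite mulrAC ler_pdivlMr ?subr_gt0 ?ltr1n // mul1r -(natrB _ (ltnW q1)) subn1.
by rewrite -natrM ler_nat mulnC.
Qed.
End UpperBound.

(** * Lower limits along an enumeration *)

Section LimInf.
Local Open Scope ereal_scope.

Lemma limn_einf_ge (R : realType) (u : (\bar R)^nat) (c : \bar R) N :
  (forall n, (N <= n)%N -> c <= u n) -> c <= limn_einf u.
Proof.
move=> cu; rewrite limn_einf_lim; apply: lime_ge; first exact: is_cvg_einfs.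
near=> n; apply/ereal_infP => _ [k /= nk <-]; apply: cu.
by apply: leq_trans nk; near: n; apply: nbhs_infty_ge.
Unshelve. all: by end_near. Qed.

Lemma limn_einf_le (R : realType) (u : (\bar R)^nat) (c : \bar R) :
  (forall N, exists2 n, (N <= n)%N & u n <= c) -> limn_einf u <= c.
Proof.
move=> uc; rewrite limn_einf_lim; apply: lime_le; first exact: is_cvg_einfs.
apply: nearW => N; have [n Nn un] := uc N.
by apply: ge_ereal_inf; exists (u n) => //; exists n.
Qed.
End LimInf.

Lemma eventually_notin_fin (T : Type) (I : finType) (e : I -> T) (s : nat -> T) :
  injective s -> exists N, forall n, (N <= n)%N -> forall i, s n <> e i.
Proof.
move=> sinj.
have /fin_all_exists[N NP] (i : I) : exists N, forall n, (N <= n)%N -> s n <> e i.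
  have [[m mE]|nm] := pselect (exists m, s m = e i); last first.
    by exists 0%N => n _ nE; apply: nm; exists n.
  exists m.+1 => n mn nE; have := sinj n m; rewrite nE mE => /(_ erefl) nm.
  by move: mn; rewrite nm ltnn.
exists (\max_i N i)%N => n Nn i; apply: NP; apply: leq_trans Nn.
exact: leq_bigmax.
Qed.

Lemma injective_nat_unbounded (f : nat -> nat) :
  injective f -> forall N, exists k, (N <= f k)%N.
Proof.
move=> finj N.
have [M MP] := @eventually_notin_fin nat 'I_N (fun i => val i) f finj.
exists M; rewrite leqNgt; apply/negP => fM.
exact: (MP M (leqnn M) (Ordinal fM)).
Qed.

Theorem theoremC (R : realType) (q : nat) (F : finFieldType) (hq : #|F| = q)
    (K : closedFieldType) (iota : {rmorphism {fraction {poly F}} -> K})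
    (algK : forall alpha : K, algebraicOver iota alpha)
    (s : nat -> K) (hs : set_bij [set: nat] (totally_Tadic iota) s) :
  ((1 / (q%:R + 1))%:E <= limn_einf (fun n => (height iota R (s n))%:E))%E /\
  (limn_einf (fun n => (height iota R (s n))%:E) <= (1 / (q%:R - 1))%:E)%E.
Proof.
have [s_fun s_inj s_surj] := hs.
have {}s_inj : injective s by move=> m n /s_inj; apply; rewrite in_setT.
rewrite -hq; split.
  have [N NP] := eventually_notin_fin (fun c : F => iota (tofrac c%:P)) s_inj.
  apply: (@limn_einf_ge _ _ _ N) => n Nn; rewrite lee_fin.
  apply: height_ge => //; first exact: s_fun.
  by move=> c; apply/eqP/NP.
apply: limn_einf_le => N.
have /choice[a aP] := exists_small_totally_Tadic algK.
have /choice[idx idxP] k : exists n, s n = a k.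
  by have [aT _ _] := aP k; have [n _] := s_surj _ aT; exists n.
have idx_inj : injective idx.
  suff lt k l : (k < l)%N -> idx k <> idx l.
    by move=> k l kl; case: (ltngtP k l) => [/lt|/lt|//] // [].
  move=> kl kl_idx; have [_ _ ak] := aP k; have [_ _ al] := aP l.
  have := iter_phi_fibers_disjoint kl ak.
  by rewrite -idxP kl_idx idxP al eqxx.
have [k Nk] := injective_nat_unbounded idx_inj N.
exists (idx k) => //; rewrite idxP lee_fin; have [_ h_le _] := aP k.
exact: h_le.
Qed.
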